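(* Let $1\le L\le K$. (1) Let $\{\lambda_A^*\}_{A\in S_K}$ be optimal measures in the problem $(\mathrm{B})$ of the context, and let $(\mathrm{B}_L)$ be its truncation to level $L$. Then the optimal values satisfy $$\mathrm{val}(\mathrm{B}_L)-\mathrm{val}(\mathrm{B})\;\le\;\sum_{k=L+1}^{K}\Big(\frac kL-1\Big)\sum_{A\in S_K,\,|A|=k}\|\lambda_A^*\|.$$ (2) Let $\{\pi_A^*\}_{A\in S_K}$ be optimal measures in the problem $(\mathrm{M})$ of the context, and let $(\mathrm{M}_L)$ be its truncation to level $L$. Then $$\mathrm{val}(\mathrm{M}_L)-\mathrm{val}(\mathrm{M})\;\le\;\sum_{k=L+1}^{K}\frac kL\sum_{A\in S_K,\,|A|=k}\|\pi_A^*\|.$$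
   Context: Let $(\mathcal{X},d)=(\mathbb{R}^p,\|\cdot\|)$, $\mathcal{Y}=\{1,\dots,K\}$, $S_K$ the set of nonempty subsets of $\mathcal{Y}$, $S_K(i)=\{A\in S_K:i\in A\}$, $S_K^L=\{A\in S_K:|A|\le L\}$, $S_K^L(i)=\{A\in S_K(i):|A|\le L\}$. $\mu_1,\dots,\mu_K$ are positive Borel measures on $\mathcal{X}$ with $\sum_i\mu_i(\mathcal{X})=1$, each $\mu_i$ having finite support $\mathcal{X}_i$. $\|\nu\|$ denotes the total mass of a positive measure $\nu$. For a budget $\varepsilon>0$, $c_\varepsilon(x,\tilde x)=0$ if $d(x,\tilde x)\le\varepsilon$ and $+\infty$ otherwise. For positive measures $\nu,\nu'$ on $\mathcal{X}$, $C_\varepsilon(\nu,\nu')=\inf_{\pi\in\Pi(\nu,\nu')}\int c_\varepsilon\,d\pi$, where $\Pi(\nu,\nu')$ is the set of positive measures on $\mathcal{X}\times\mathcal{X}$ with marginals $\nu,\nu'$, and $C_\varepsilon(\nu,\nu')=\infty$ if $\|\nu\|\ne\|\nu'\|$. Problem (B): minimize $$\sum_{A\in S_K}\Big(\lambda_A(\mathcal{X})+\sum_{i\in A}C_\varepsilon(\lambda_A,\mu_{i,A})\Big)$$ over families of positive measures $(\lambda_A)_{A\in S_K}$, $(\mu_{i,A})_{A\in S_K,\,i\in A}$ on $\mathcal{X}$ with $\sum_{A\in S_K(i)}\mu_{i,A}=\mu_i$ for all $i\in\mathcal{Y}$. Problem $(\mathrm{B}_L)$ is (B) with the additional constraint $\mu_{i,A}=0$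 and $\lambda_A=0$ whenever $|A|>L$. Problem (M): with $\mathcal{X}^A=\prod_{i\in A}\mathcal{X}_i$, $x_A=(x_i)_{i\in A}$, and $c_{\varepsilon,A}(x_A)=\inf_{x'\in\mathcal{X}}\sum_{i\in A}c_\varepsilon(x',x_i)$ (so $c_{\varepsilon,\{i\}}=0$), minimize $$\sum_{A\in S_K}\int_{\mathcal{X}^A}(1+c_{\varepsilon,A}(x_A))\,d\pi_A(x_A)$$ over positive measures $\pi_A$ on $\mathcal{X}^A$ such that $\sum_{A\in S_K(i)}{\mathcal{P}_i}_\#\pi_A=\mu_i$ for all $i\in\mathcal{Y}$, where $\mathcal{P}_i(x_A)=x_i$. Problem $(\mathrm{M}_L)$ is the same with $S_K,S_K(i)$ replaced by $S_K^L,S_K^L(i)$ (i.e. $\pi_A=0$ for $|A|>L$). $\mathrm{val}$ denotes the optimal (minimal) value. *)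

(* Defs.v *)
From HB Require Import structures.
From mathcomp Require Import all_boot all_order all_algebra.
From mathcomp Require Import all_classical all_reals all_analysis.

Set Implicit Arguments.
Unset Strict Implicit.
Unset Printing Implicit Defensive.

Import Order.TTheory GRing.Theory Num.Theory.
Import numFieldNormedType.Exports.

Local Open Scope classical_set_scope.
Local Open Scope ring_scope.
Local Open Scope ereal_scope.

(* The metric comes from an arbitrary norm [N], not from the library's sup norm
   on row vectors; all norms on R^p induce the same topology, hence the same
   Borel sets, so the topology of ['rV[R]_p] is used for the latter. *)
Record is_norm (R : realType) (p : nat) (N : 'rV[R]_p -> R) : Prop := {
  is_norm_triangle : forall x y, (N (x + y) <= N x + N y)%R ;
  is_norm_homog : forall (a : R) x, N (a *: x)%R = (`|a| * N x)%R ;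
  is_norm_definite : forall x, N x = 0%R -> x = 0%R }.

Definition borelRV (R : realType) (p : nat) :=
  g_sigma_algebraType (@open 'rV[R]_p).

Definition msupport (R : realType) (p : nat)
    (nu : {measure set (borelRV R p) -> \bar R}) : set 'rV[R]_p :=
  [set x | forall U : set 'rV[R]_p, open U -> U x -> 0 < nu U].

Section index_sets.
Variable K : nat.

Definition SK : {set {set 'I_K}} := [set A : {set 'I_K} | A != finset.set0]%SET.

Definition SKL (L : nat) : {set {set 'I_K}} :=
  [set A in SK | (#|A| <= L)%N]%SET.

End index_sets.
Arguments SK : clear implicits.
Arguments SKL : clear implicits.

Section transport_cost.
Variables (R : realType) (p : nat) (N : 'rV[R]_p -> R) (eps : R).
Local Notation X := (borelRV R p).

Definition ceps (x y : 'rV[R]_p) : \bar R :=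
  if (N (x - y) <= eps)%R then 0 else +oo.

Definition couplings (nu nu' : {measure set X -> \bar R}) :
    set {measure set (X * X)%type -> \bar R} :=
  [set pi | forall U : set X, measurable U ->
     pushforward pi fst U = nu U /\ pushforward pi snd U = nu' U].

Definition Ceps (nu nu' : {measure set X -> \bar R}) : \bar R :=
  if nu setT == nu' setT
  then ereal_inf [set \int[pi]_z ceps z.1 z.2 | pi in couplings nu nu']
  else +oo.

End transport_cost.

Section problem_B.
Variables (R : realType) (p K : nat) (N : 'rV[R]_p -> R) (eps : R).
Local Notation X := (borelRV R p).
Variable mu : 'I_K -> {measure set X -> \bar R}.

(* Families are indexed by all [A : {set 'I_K}] and all [i : 'I_K]; only the
   components with [A] nonempty and [i \in A] are ever used. Measures are
   compared on measurable sets only, since their values elsewhere carry no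
   meaning. *)
Implicit Types (lambda : {set 'I_K} -> {measure set X -> \bar R})
  (m : 'I_K -> {set 'I_K} -> {measure set X -> \bar R}).

Definition objB lambda m : \bar R :=
  \sum_(A in SK K)
    (lambda A setT + \sum_(i in A) Ceps N eps (lambda A) (m i A)).

Definition feasibleB lambda m : Prop :=
  forall i (U : set X), measurable U ->
    \sum_(A in SK K | i \in A) m i A U = mu i U.

Definition feasibleBL (L : nat) lambda m : Prop :=
  feasibleB lambda m /\
  forall A, A \in SK K -> (L < #|A|)%N ->
    forall U : set X, measurable U ->
      lambda A U = 0 /\ forall i, i \in A -> m i A U = 0.

Definition optvalB : \bar R :=
  ereal_inf [set v | exists lambda m, feasibleB lambda m /\ v = objB lambda m].

Definition optvalBL (L : nat) : \bar R :=
  ereal_inf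
    [set v | exists lambda m, feasibleBL L lambda m /\ v = objB lambda m].

Definition optimalB lambda m : Prop :=
  feasibleB lambda m /\ objB lambda m = optvalB.

End problem_B.

Section product_space.
Variables (R : realType) (p K : nat).
Local Notation X := (borelRV R p).

Definition cylinders (A : {set 'I_K}) : set (set ({i | i \in A} -> X)) :=
  [set B | exists (j : {i | i \in A}) (U : set X),
     measurable U /\ B = (fun x => x j) @^-1` U].

(* (R^p)^A with its product sigma-algebra. *)
Definition prodRV (A : {set 'I_K}) := g_sigma_algebraType (@cylinders A).

(* The product of the supports. It may be empty, so it cannot carry a
   [measurableType] itself: measures on it are the measures on (R^p)^A that
   vanish on its complement. *)
Definition supp_prod (mu : 'I_K -> {measure set X -> \bar R}) (A : {set 'I_K}) :
    set (prodRV A) :=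
  [set x | forall j : {i | i \in A}, msupport (mu (val j)) (x j)].

(* The default value 0 is only returned when [i \notin A]. *)
Definition coord (A : {set 'I_K}) (i : 'I_K) (x : prodRV A) : X :=
  if @insub _ (fun i => i \in A) _ i is Some j then x j else (0%R : 'rV[R]_p).

End product_space.
Arguments supp_prod {R p K} mu A.

Section problem_M.
Variables (R : realType) (p K : nat) (N : 'rV[R]_p -> R) (eps : R).
Local Notation X := (borelRV R p).
Variable mu : 'I_K -> {measure set X -> \bar R}.
(* [SK K] for the full problem, [SKL K L] for its truncation. *)
Variable S : {set {set 'I_K}}.

Definition cepsA (A : {set 'I_K}) (x : prodRV R p A) : \bar R :=
  ereal_inf [set \sum_(j : {i | i \in A}) ceps N eps x' (x j)
            | x' in [set: 'rV[R]_p]].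

Implicit Types pi : forall A : {set 'I_K},
  {measure set (prodRV R p A) -> \bar R}.

Definition objM pi : \bar R :=
  \sum_(A in S) \int[pi A]_(x in supp_prod mu A) (1 + cepsA x).

Definition feasibleM pi : Prop :=
  (forall A, A \in S -> pi A (~` supp_prod mu A) = 0) /\
  forall i (U : set X), measurable U ->
    \sum_(A in S | i \in A)
       pushforward (pi A) (coord i : prodRV R p A -> X) U = mu i U.

Definition optvalM : \bar R :=
  ereal_inf [set v | exists pi, feasibleM pi /\ v = objM pi].

Definition optimalM pi : Prop := feasibleM pi /\ objM pi = optvalM.

End problem_M.

(* Main.v *)
(** Split every label set [A] with [|A| > L] evenly over its subsets [B] of size
[L]: each [B] receives the fraction [1 / 'C(|A| - 1, L - 1)] of the measures
attached to [A] (pushed forward to the coordinates in [B] for problem (M)).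
A label [i] of [A] lies in exactly ['C(|A| - 1, L - 1)] such [B], so the marginal
constraints are preserved, while the total mass is multiplied by [|A| / L].
Transport costs are 0 or [+oo]: at a solution of finite value they vanish, they
still vanish for the split measures, and only the mass changes. *)

Require Import Defs.
From mathcomp Require Import all_boot all_order all_algebra.
From mathcomp Require Import all_classical all_reals all_analysis.
From mathcomp Require Import measurable_realfun.

Set Implicit Arguments.
Unset Strict Implicit.
Unset Printing Implicit Defensive.

Import Order.TTheory GRing.Theory Num.Theory.
Import numFieldNormedType.Exports.

Local Open Scope classical_set_scope.
Local Open Scope ring_scope.
Local Open Scope ereal_scope.

(** * Lower integrals of nonnegative functions, measurable or not *)

(* [integral] of a nonnegative function is the supremum over simple functions
   below it, so these bounds need no measurability; this dispenses with the
   measurability of the transport costs. *)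
Section lower_integral.
Import HBNNSimple.
Context {d : measure_display} {T : measurableType d} {R : realType}.
Implicit Types (mu : {measure set T -> \bar R}) (f : T -> \bar R).

Lemma integral_le_nnsfun mu f M : (forall x, 0 <= f x) ->
  (forall h : {nnsfun T >-> R}, (forall x, (h x)%:E <= f x) ->
     \int[mu]_x (h x)%:E <= M) ->
  \int[mu]_x f x <= M.
Proof.
move=> f0 H; rewrite ge0_integralTE//; apply: ge_ereal_sup => _ [h /= hf <-].
by rewrite -integralT_nnsfun; exact: H.
Qed.

Lemma nnsfun_le_integral mu f (h : {nnsfun T >-> R}) : (forall x, 0 <= f x) ->
  (forall x, (h x)%:E <= f x) -> \int[mu]_x (h x)%:E <= \int[mu]_x f x.
Proof.
move=> f0 hf; rewrite integralT_nnsfun (ge0_integralTE mu f0).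
by apply: ereal_sup_ubound; exists h.
Qed.

Lemma ge0_le_lower_integral mu (f g : T -> \bar R) : (forall x, 0 <= f x) ->
  (forall x, f x <= g x) -> \int[mu]_x f x <= \int[mu]_x g x.
Proof.
move=> f0 fg; apply: integral_le_nnsfun => // h hf.
apply: nnsfun_le_integral => x; last exact: le_trans (fg x).
exact: le_trans (fg x).
Qed.

(* A simple function below [f] exceeds [a] only on a set where [f] is [+oo]. *)
Lemma integral_le_two_valued mu f (a : R) : (0 <= a)%R ->
  (forall x, 0 <= f x) -> (forall x, f x <= a%:E \/ f x = +oo) ->
  \int[mu]_x f x < +oo -> \int[mu]_x f x <= a%:E * mu setT.
Proof.
move=> a0 f0 fa foo; apply: integral_le_nnsfun => // h hf.
pose F := [set x | (a < h x)%R].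
have mF : measurable F.
  have -> : F = h @^-1` `]a, +oo[ by apply/seteqP; split => x /=; rewrite in_itv/= andbT.
  exact: measurable_funPTI.
have Foo x : F x -> f x = +oo.
  move=> Fx; case: (fa x) => // fxa; have := le_trans (hf x) fxa.
  by rewrite lee_fin leNgt Fx.
have F0 : mu F = 0.
  apply/eqP/negPn/negP => muF.
  have muF0 : 0 < mu F by rewrite lt0e muF measure_ge0.
  (* Every multiple [n] of the indicator of [F] is a simple function below [f], so a non-null [F]
     would force an infinite integral. *)
  have big (n : nat) : n%:R%:E * mu F <= \int[mu]_x f x.
    have -> : n%:R%:E * mu F = \int[mu]_x (n%:R * \1_F x)%:E.
      under eq_integral do rewrite EFinM.
      rewrite ge0_integralZl//; last exact/measurable_EFinP.
      by rewrite integral_indic// setIT.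
    have n0 : (0 <= n%:R :> R)%R by [].
    apply: (@nnsfun_le_integral mu f (scale_nnsfun (indic_nnsfun R mF) n0)) => // x.
    rewrite /= /indic mindicE; case: (boolP (x \in F)) => [/set_mem/Foo->|_].
      by rewrite leey.
    by rewrite mulr0.
  have I0 : 0 <= \int[mu]_x f x by apply: integral_ge0.
  move: foo I0 muF0 big {muF}; move: (\int[mu]_x f x) (mu F) => [i||] [r||]// _ i0 r0.
  - move=> /(_ (Num.bound (i / r))); rewrite -EFinM lee_fin leNgt => /negP; apply.
    rewrite -ltr_pdivrMr//; exact: archi_boundP (divr_ge0 i0 (ltW r0)).
  - by move=> /(_ 1%N); rewrite mul1e.
(* Outside the null set [F] the simple function [h] is at most [a]. *)
apply: (@le_trans _ _ (\int[mu]_x (cst a%:E x))); last by rewrite integral_cst.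
apply: ae_ge0_le_integral => //.
- by move=> x _; rewrite lee_fin.
- exact/measurable_EFinP.
exists F; split => // x /= nx; rewrite /F /= ltNge; apply/negP => hx; apply: nx => _.
by rewrite lee_fin.
Qed.

End lower_integral.

(** * Finite weighted sums of measures *)

Section mixture.
Context {d : measure_display} {T : measurableType d} {R : realType}.
Context {I : finType}.
Import HBNNSimple.
Implicit Types (w : I -> {nonneg R}) (m : I -> {measure set T -> \bar R}).

(** [msum] sums a sequence indexed by [nat], so the family is listed first; the default [mzero] is
    never read below [#|I|]. *)
Definition mixture w m : {measure set T -> \bar R} :=
  msum (nth (mzero : {measure set T -> \bar R})
         [seq (mscale (w i) (m i) : {measure set T -> \bar R}) | i : I]) #|I|.

Lemma mixtureE w m U : mixture w m U = \sum_i (w i)%:num%:E * m i U.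
Proof.
rewrite /mixture /= /msum.
rewrite -(big_mkord xpredT (fun k => (nth (mzero : {measure set T -> \bar R})
         [seq (mscale (w i) (m i) : {measure set T -> \bar R}) | i : I]) k U)).
rewrite -[#|I|](size_image (fun i => (mscale (w i) (m i) : {measure set T -> \bar R}))).
rewrite -(big_nth _ xpredT (fun nu : {measure set T -> \bar R} => nu U)).
by rewrite big_map -big_enum.
Qed.

(** The integral of a simple function is additive in the measure, and each term is at most the lower
    integral of [f]. *)
Lemma integral_mixture_le w m (f : T -> \bar R) : (forall x, 0 <= f x) ->
  \int[mixture w m]_x f x <= \sum_i (w i)%:num%:E * \int[m i]_x f x.
Proof.
move=> f0; apply: integral_le_nnsfun => // h hf.
have h0 x : [set: T] x -> 0 <= (h x)%:E by rewrite lee_fin.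
have mh : measurable_fun [set: T] (EFin \o h) by exact/measurable_EFinP.
rewrite ge0_integral_measure_sum//.
rewrite -(big_mkord xpredT (fun k => \int[nth (mzero : {measure set T -> \bar R})
         [seq (mscale (w i) (m i) : {measure set T -> \bar R}) | i : I] k]_x (h x)%:E)).
rewrite -[#|I|](size_image (fun i => (mscale (w i) (m i) : {measure set T -> \bar R}))).
rewrite -(big_nth _ xpredT (fun nu : {measure set T -> \bar R} => \int[nu]_x (h x)%:E)).
rewrite big_map -big_enum /=; apply: lee_sum => i _.
rewrite ge0_integral_mscale//; apply: lee_wpmul2l; first by rewrite lee_fin.
exact: nnsfun_le_integral.
Qed.

End mixture.

(** * Image measures and null sets under the lower integral *)

Definition image_measure {d d' : measure_display} {T1 : measurableType d}
  {T2 : measurableType d'} {R : realType} (m : {measure set T1 -> \bar R})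
  {f : T1 -> T2} (mf : measurable_fun [set: T1] f) :
  {measure set T2 -> \bar R} :=
  measure_function_pushforward__canonical__measure_function_Measure m mf.

Section null_sets_and_images.
Import HBNNSimple.

(** A simple function below [g] pulls back to one below the composite. One below the composite need
    not factor through [f], hence an inequality only. *)
Lemma integral_image_measure_le {d d' : measure_display} {T1 : measurableType d}
  {T2 : measurableType d'} {R : realType} (m : {measure set T1 -> \bar R})
  {f : T1 -> T2} (mf : measurable_fun [set: T1] f) (g : T2 -> \bar R) :
  (forall x, 0 <= g x) ->
  \int[image_measure m mf]_x g x <= \int[m]_x g (f x).
Proof.
move=> g0; apply: integral_le_nnsfun => // h hg.
have h0 x : [set: T2] x -> 0 <= (h x)%:E by rewrite lee_fin.
have mh : measurable_fun [set: T2] (EFin \o h) by exact/measurable_EFinP.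
rewrite ge0_integral_pushforward//=; last by move=> x _; exact: h0.
rewrite preimage_setT; apply: ge0_le_lower_integral => x; last exact: hg.
by rewrite lee_fin.
Qed.

(** A simple function below [f] loses nothing when integrated over [D] alone, its complement being
    null. *)
Lemma integral_le_of_null_setC {d : measure_display} {T : measurableType d}
  {R : realType} (mu : {measure set T -> \bar R}) (D : set T) (f : T -> \bar R) :
  measurable D -> mu (~` D) = 0 -> (forall x, 0 <= f x) ->
  \int[mu]_x f x <= \int[mu]_(x in D) f x.
Proof.
move=> mD D0 f0; apply: integral_le_nnsfun => // h hf.
have h0 x : [set: T] x -> 0 <= (h x)%:E by rewrite lee_fin.
have mh : measurable_fun [set: T] (EFin \o h) by exact/measurable_EFinP.
rewrite (ge0_negligible_integral _ _ _ _ D0)//; last exact: measurableC.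
rewrite setTD setCK [leLHS]integral_mkcond [leRHS]integral_mkcond.
apply: ge0_le_lower_integral => x; rewrite !patchE; case: ifP => // _.
by rewrite lee_fin.
Qed.

End null_sets_and_images.

(** * Splitting weights and their double counting *)

Lemma cards_draws_containing (T : finType) (A : {set T}) (i : T) (k : nat) :
  i \in A ->
  #|[set B : {set T} | [&& B \subset A, #|B| == k.+1 & i \in B]]%SET|
  = 'C(#|A|.-1, k).
Proof.
move=> iA; pose D := [set B : {set T} | B \subset A & #|B| == k.+1]%SET.
have DA : #|D| = 'C(#|A|, k.+1) by rewrite -cards_draws.
have DAi : #|(D :\: [set B : {set T} | i \in B])%SET| = 'C(#|A|.-1, k.+1).
  rewrite [in RHS](cardsD1 i) iA add1n /= -cards_draws; apply: eq_card => B.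
  by rewrite !inE subsetD1 andbA [(_ \notin _) && _]andbC.
(* Removing the subsets that avoid [i] from all subsets of size [k.+1] leaves the count given by
   Pascal's rule. *)
have := cardsID [set B : {set T} | i \in B]%SET D.
rewrite DAi DA -{2}(@prednK #|A|); last by rewrite card_gt0; apply/set0Pn; exists i.
rewrite binS addnC => /addnI <-; apply: eq_card => B.
by rewrite !inE andbA.
Qed.

Section weights.
Variables (R : realType) (K L : nat).
Hypothesis L0 : (0 < L)%N.

(* Splitting [A] evenly over its subsets [B] of size [L]: each element of [A] lies in
   ['C(#|A|.-1, L.-1)] of them, hence the normalization. *)
Definition weight (A B : {set 'I_K}) : R :=
  if (#|A| <= L)%N then (B == A)%:R
  else if (B \subset A) && (#|B| == L) then ('C(#|A|.-1, L.-1)%:R)^-1%R else 0%R.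

Lemma weight_ge0 (A B : {set 'I_K}) : (0 <= weight A B)%R.
Proof. by rewrite /weight; case: ifP => // _; case: ifP. Qed.

(** The arguments are swapped so that [nng_weight L B] is the family of weights over the sources
    [A], as [mixture] expects. *)
Definition nng_weight (B A : {set 'I_K}) : {nonneg R} := NngNum (weight_ge0 A B).

Lemma weight_neq0 (A B : {set 'I_K}) : weight A B != 0%R ->
  B \subset A /\ (#|B| <= L)%N.
Proof.
rewrite /weight; case: ifP => [AL|_].
  by case: (eqVneq B A) => [-> //|]; rewrite eqxx.
by case: ifP => [/andP[-> /eqP->]//|]; rewrite eqxx.
Qed.

Lemma sum_weight_containing (A : {set 'I_K}) i : i \in A ->
  (\sum_(B in SKL K L | i \in B) weight A B = 1)%R.
Proof.
move=> iA; have A0 : A != finset.set0 by apply/set0Pn; exists i.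
have [AL|AL] := leqP #|A| L.
  rewrite (bigD1 A)/=; last by rewrite !inE A0 AL iA.
  rewrite /weight AL eqxx big1 ?addr0// => B /andP[_ /negPf->//].
rewrite /weight leqNgt AL /= -big_mkcondr /=.
rewrite (eq_bigl (mem [set B : {set 'I_K} | [&& B \subset A, #|B| == L.-1.+1 & i \in B]]%SET)).
  rewrite sumr_const cards_draws_containing// -[RHS](@mulVf _ ('C(#|A|.-1, L.-1)%:R : R)).
    by rewrite mulr_natr.
  (* The binomial coefficient is invertible because [L <= #|A|]. *)
  rewrite pnatr_eq0 -lt0n bin_gt0.
  by rewrite -ltnS !prednK ?card_gt0// ltnW.
move=> B; rewrite !inE prednK//; case: (boolP (i \in B)) => iB; rewrite ?andbF//=.
have -> : B != finset.set0 by apply/set0Pn; exists i.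
by case: eqVneq => [->|_]; rewrite ?leqnn ?andbF ?andbT.
Qed.

(** Double counting of the labels in the sets [B]: if [#|A| > L], a [B] of nonzero weight has [L]
    labels, all in [A], and each of the [#|A|] labels collects total weight 1. *)
Lemma sum_weight (A : {set 'I_K}) : A \in SK K ->
  (\sum_(B in SKL K L) weight A B = if (#|A| <= L)%N then 1 else #|A|%:R / L%:R)%R.
Proof.
rewrite inE => A0; case: ifP => AL.
  rewrite (bigD1 A) ?inE ?A0 ?AL//= /weight AL eqxx big1 ?addr0//.
  by move=> B /andP[_ /negPf->].
have LR : (L%:R != 0 :> R)%R by rewrite pnatr_eq0 -lt0n.
apply: (mulIf LR); rewrite mulfVK//.
rewrite -[RHS]mulr1 mulr_natl -sumr_const.
under [RHS]eq_bigr => i iA do rewrite -(sum_weight_containing iA).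
rewrite (exchange_big_dep (fun B => B \in SKL K L))/=; last by move=> i B _ /andP[].
rewrite mulr_suml; apply: eq_bigr => B BS.
rewrite /weight AL; case: ifP => [/andP[BA /eqP BL]|_]; last by rewrite mul0r big1.
rewrite sumr_const mulr_natr; congr (_ *+ _)%R; rewrite -[LHS]BL; apply: eq_card => i.
by rewrite [RHS]unfold_in BS /= andb_idl// => /(fintype.subsetP BA).
Qed.

Implicit Types (a : {set 'I_K} -> \bar R).

(** Sets with more than [L] labels receive weight 0 from every [A]. *)
Lemma sum_weight_SKL a (P : pred {set 'I_K}) :
  \sum_(B in SK K | P B) \sum_A (weight A B)%:E * a A =
  \sum_(B in SKL K L | P B) \sum_A (weight A B)%:E * a A.
Proof.
rewrite big_mkcond [RHS]big_mkcond; apply: eq_bigr => B _; rewrite !inE.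
case: (B != _) => //=; case: (P B); rewrite ?andbF//= andbT.
case: ifPn => // BL; rewrite big1// => A _.
case: (eqVneq (weight A B) 0%R) => [->|/weight_neq0[_]]; first by rewrite mul0e.
by rewrite (negPf BL).
Qed.

Lemma exchange_weight a (P : pred {set 'I_K}) : (forall A, 0 <= a A) ->
  \sum_(B in SKL K L | P B) \sum_A (weight A B)%:E * a A =
  \sum_(A in SK K) (\sum_(B in SKL K L | P B) weight A B)%:E * a A.
Proof.
move=> a0; rewrite exchange_big /= [RHS]big_mkcond; apply: eq_bigr => A _.
rewrite -ge0_sume_distrl; last by move=> B _; rewrite lee_fin weight_ge0.
(* The sum over [A] also meets the empty set, whose only nonzero weight goes to the empty [B],
   absent from [SKL K L]. *)
rewrite sumEFin; case: ifPn => //; rewrite inE negbK => /eqP ->.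
rewrite big1 ?mul0e// => B /andP[+ _]; rewrite !inE => /andP[B0 _].
by rewrite /weight cards0 leq0n (negPf B0).
Qed.

Lemma sum_weight_marginal a i : (forall A, 0 <= a A) ->
  \sum_(B in SKL K L | i \in B) \sum_A (weight A B)%:E * a A =
  \sum_(A in SK K | i \in A) a A.
Proof.
move=> a0; rewrite exchange_weight// [RHS]big_mkcondr /=; apply: eq_bigr => A _.
case: ifPn => iA; first by rewrite sum_weight_containing// mul1e.
rewrite big1 ?mul0e// => B /andP[_ iB].
case: (eqVneq (weight A B) 0%R) => // /weight_neq0[/fintype.subsetP/(_ _ iB)].
by rewrite (negPf iA).
Qed.

(** A set with [#|A| > L] passes on [#|A| / L] times its value: the value itself plus an excess,
    which is then grouped by cardinality. *)
Lemma sum_weight_mass a : (forall A, 0 <= a A) ->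
  \sum_(B in SKL K L) \sum_A (weight A B)%:E * a A =
  \sum_(A in SK K) a A +
  \sum_(L.+1 <= k < K.+1)
    ((k%:R / L%:R - 1)%R%:E * \sum_(A in SK K | #|A| == k) a A).
Proof.
move=> a0; have := exchange_weight xpredT a0.
rewrite (eq_bigl (mem (SKL K L))); last by move=> B; rewrite andbT.
move=> ->; under [X in _ + X]eq_bigr do rewrite ge0_sume_distrr//.
rewrite (exchange_big_dep (fun A => A \in SK K))/=; last by move=> k A _ /andP[].
rewrite -big_split /=; apply: eq_bigr => A AS.
rewrite AS /= (eq_bigl (mem (SKL K L))); last by move=> B; rewrite andbT.
(* Only the level [k = #|A|] sees [A]; as [#|A| <= K], it is in range exactly when [L < #|A|]. *)
rewrite (eq_bigl (fun k => k == #|A|)) => [|k]; last by rewrite eq_sym.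
rewrite big_nat1_eq sum_weight// ltnS.
have -> : (#|A| <= K)%N by rewrite -[X in (_ <= X)%N]card_ord max_card.
rewrite andbT leqNgt; case: ltnP => AL /=; last by rewrite mul1e adde0.
have AL1 : (1 <= #|A|%:R / L%:R :> R)%R.
  by rewrite ler_pdivlMr ?ltr0n// mul1r ler_nat ltnW.
(* [a A] may be infinite; both coefficients are nonnegative, so distributivity still holds. *)
rewrite -[X in X + _]mul1e -ge0_muleDl//; last by rewrite lee_fin subr_ge0.
by rewrite -EFinD subrKC.
Qed.

End weights.
Arguments nng_weight {R K} L B A.

(** * Infima and differences of extended reals *)

Lemma ereal_inf_eq_pinfty {R : realType} (S : set \bar R) :
  (forall v, S v -> v = +oo) -> ereal_inf S = +oo.
Proof.
move=> Soo; apply/eqP; rewrite -leye_eq; apply: le_ereal_inf_tmp => v /Soo->.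
by rewrite leey.
Qed.

(* Pitfall: [+oo - +oo] is [-oo], so an infinite value makes the bound trivial. *)
Lemma sube_le_of_attained {R : realType} (v v' o r : \bar R) : 0 <= o -> o = v ->
  (o < +oo -> v' <= o + r) -> 0 <= r -> v' - v <= r.
Proof.
move=> + <-; case: o => [s||]// _ H r0; last by rewrite addeNy leNye.
by rewrite leeBlDr// addeC; apply: H; exact: ltry.
Qed.

(** * Couplings of zero transport cost *)

Section coupling_mixture.
Context {R : realType} {p : nat} (N : 'rV[R]_p -> R) (eps : R).
Local Notation X := (borelRV R p).

Lemma ceps_ge0 x y : 0 <= ceps N eps x y.
Proof. by rewrite /ceps; case: ifP. Qed.

Lemma Ceps_ge0 nu nu' : 0 <= Ceps N eps nu nu'.
Proof.
rewrite /Ceps; case: ifP => // _; apply: le_ereal_inf_tmp => _ [pi _ <-].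
by apply: integral_ge0 => z _; exact: ceps_ge0.
Qed.

Definition free_coupling (nu nu' : {measure set X -> \bar R})
    (pi : {measure set (X * X)%type -> \bar R}) :=
  couplings nu nu' pi /\ \int[pi]_z ceps N eps z.1 z.2 = 0.

(** A finite infimum yields a coupling of finite cost; since [ceps] takes only the values 0 and
    [+oo], that cost is 0. *)
Lemma Ceps_lt_pinfty nu nu' : Ceps N eps nu nu' < +oo ->
  exists pi, free_coupling nu nu' pi.
Proof.
rewrite /Ceps; case: ifP => // _ /ereal_inf_lt[_ [pi cpi <-] pioo].
exists pi; split=> //; apply/eqP; rewrite eq_le; apply/andP; split.
  rewrite -(mul0e (pi setT)); apply: integral_le_two_valued => //.
    by move=> z; exact: ceps_ge0.
  by move=> z; rewrite /ceps; case: ifP; [left|right].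
by apply: integral_ge0 => z _; exact: ceps_ge0.
Qed.

(** Mixing zero-cost couplings with the same weights gives a zero-cost coupling of the mixtures. *)
Lemma Ceps_mixture (I : finType) (w : I -> {nonneg R})
    (nu nu' : I -> {measure set X -> \bar R}) :
  (forall i, (w i)%:num%R != 0%R -> Ceps N eps (nu i) (nu' i) < +oo) ->
  Ceps N eps (mixture w nu) (mixture w nu') = 0.
Proof.
move=> fin; apply/eqP; rewrite eq_le Ceps_ge0 andbT.
have /choice[pi piP] i : exists pi, (w i)%:num%R != 0%R -> free_coupling (nu i) (nu' i) pi.
  case: (eqVneq (w i)%:num%R 0%R) => [_|/fin/Ceps_lt_pinfty[pi ?]].
    (* At weight 0 no coupling need exist, and any measure will do. *)
    by exists mzero.
  by exists pi.
have mix_pi : couplings (mixture w nu) (mixture w nu') (mixture w pi).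
  move=> U mU; rewrite /pushforward !mixtureE; split; apply: eq_bigr => i _.
    case: (eqVneq (w i)%:num%R 0%R) => [->|/piP[/(_ U mU)[<- _] _]//].
    by rewrite !mul0e.
  case: (eqVneq (w i)%:num%R 0%R) => [->|/piP[/(_ U mU)[_ <-] _]//].
  by rewrite !mul0e.
(* Equal masses rule out the [+oo] branch of [Ceps]; both equal the mass of the mixed coupling. *)
have massE : mixture w nu setT = mixture w nu' setT.
  have [<- <-] := mix_pi setT measurableT.
  by rewrite /pushforward !preimage_setT.
rewrite /Ceps massE eqxx.
apply: (@le_trans _ _ (\int[mixture w pi]_z ceps N eps z.1 z.2)).
  by apply: ereal_inf_lbound; exists (mixture w pi).
have c0 (z : X * X) : 0 <= ceps N eps z.1 z.2 by exact: ceps_ge0.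
apply: (le_trans (integral_mixture_le w pi c0)).
rewrite big1// => i _; case: (eqVneq (w i)%:num%R 0%R) => [->|/piP[_ ->]].
  by rewrite mul0e.
by rewrite mule0.
Qed.

End coupling_mixture.

Lemma lte_sum_term {R : realDomainType} (I : finType) (P : pred I) (F : I -> \bar R) i :
  (forall j, P j -> 0 <= F j) -> \sum_(j | P j) F j < +oo -> P i -> F i < +oo.
Proof.
move=> F0 + Pi; rewrite (bigD1 i)//=; apply: le_lt_trans; apply: leeDl.
by apply: sume_ge0 => j /andP[+ _]; exact: F0.
Qed.

(** * Truncation of problem (B) *)

Section truncation_B.
Context {R : realType} {p K L : nat} (N : 'rV[R]_p -> R) (eps : R).
Variables (mu : 'I_K -> {measure set (borelRV R p) -> \bar R}).
Variables (lambda : {set 'I_K} -> {measure set (borelRV R p) -> \bar R})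
  (m : 'I_K -> {set 'I_K} -> {measure set (borelRV R p) -> \bar R}).
Hypothesis L0 : (0 < L)%N.

Let lambda' B := mixture (nng_weight L B) lambda.
Let m' i B := mixture (nng_weight L B) (m i).

Lemma objB_ge0 : 0 <= objB N eps lambda m.
Proof.
apply: sume_ge0 => A _; apply: adde_ge0; first exact: measure_ge0.
by apply: sume_ge0 => i _; exact: Ceps_ge0.
Qed.

Lemma truncated_feasibleB : feasibleB mu lambda m -> feasibleBL mu L lambda' m'.
Proof.
move=> feas; split=> [i U mU|B BS BL U mU].
  rewrite -(feas i U mU) -(sum_weight_marginal L0 (a := fun A => m i A U))//.
  rewrite -(sum_weight_SKL L _ (fun B => i \in B)).
  by apply: eq_bigr => B _; rewrite /m' mixtureE.
have w0 A : ((nng_weight L B A : {nonneg R})%:num)%R = 0%R.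
  rewrite /=; case: (eqVneq (weight R L A B) 0%R) => // /weight_neq0[_].
  by rewrite leqNgt BL.
by split=> [|i _]; rewrite /m' /lambda' mixtureE big1// => A _; rewrite w0 mul0e.
Qed.

(** Finiteness of the objective makes every transport cost finite, so by [Ceps_mixture] the split
    family pays for mass only. *)
Lemma objB_truncated_le : objB N eps lambda m < +oo ->
  objB N eps lambda' m' <= objB N eps lambda m +
    \sum_(L.+1 <= k < K.+1)
      ((k%:R / L%:R - 1)%R%:E * \sum_(A in SK K | #|A| == k) lambda A setT).
Proof.
move=> fin.
have Cfin A i : A \in SK K -> i \in A -> Ceps N eps (lambda A) (m i A) < +oo.
  move=> AS iA.
  have sumC_ge0 (A' : {set 'I_K}) : 0 <= \sum_(i in A') Ceps N eps (lambda A') (m i A').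
    by apply: sume_ge0 => j _; exact: Ceps_ge0.
  apply: (lte_sum_term (P := mem A) (F := fun i => Ceps N eps (lambda A) (m i A))) => //.
    by move=> j _; exact: Ceps_ge0.
  apply: (@le_lt_trans _ _ (lambda A setT + \sum_(i in A) Ceps N eps (lambda A) (m i A))).
    by rewrite leeDr.
  apply: (lte_sum_term (P := mem (SK K))
    (F := fun A => lambda A setT + \sum_(i in A) Ceps N eps (lambda A) (m i A))) => //.
  by move=> A' _; exact: adde_ge0.
have -> : objB N eps lambda' m' =
    \sum_(B in SK K) \sum_A (weight R L A B)%:E * lambda A setT.
  apply: eq_bigr => B BS; rewrite /lambda' mixtureE [X in _ + X]big1 ?adde0// => i iB.
  (* A nonzero weight forces [B \subset A], so the label [i] of [B] indexes a finite cost at [A]. *)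
  apply: Ceps_mixture => A /weight_neq0[/fintype.subsetP BA _].
  have iA := BA _ iB; apply: Cfin => //.
  by rewrite inE; apply/set0Pn; exists i.
have := sum_weight_SKL L (fun A => lambda A setT) xpredT.
rewrite (eq_bigl (mem (SK K))) => [->|B]; last by rewrite andbT.
rewrite (eq_bigl (mem (SKL K L))) => [|B]; last by rewrite andbT.
rewrite (sum_weight_mass L0)//; apply: leeD => //.
apply: lee_sum => A _; rewrite leeDl//.
by apply: sume_ge0 => j _; exact: Ceps_ge0.
Qed.

End truncation_B.

(** * Truncation of problem (M) *)

Section truncation_M.
Context {R : realType} {p K : nat} (N : 'rV[R]_p -> R) (eps : R).
Local Notation X := (borelRV R p).
Local Notation Y := (prodRV R p).
Implicit Types (A B : {set 'I_K}) (i : 'I_K).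

Lemma coord_val A (x : Y A) (j : {i | i \in A}) : Defs.coord (val j) x = x j.
Proof. by rewrite /Defs.coord valK. Qed.

Lemma measurable_coord A i : measurable_fun [set: Y A] (Defs.coord i : Y A -> X).
Proof.
have [iA|iA] := boolP (i \in A).
  have -> : Defs.coord i = (fun x : Y A => x (Sub i iA)).
    by apply/funext => x; rewrite /Defs.coord insubT.
  move=> _ U mU; rewrite setTI; apply: sub_sigma_algebra.
  by exists (Sub i iA), U.
have -> : Defs.coord i = (fun=> 0%R : 'rV[R]_p) :> (Y A -> X).
  by apply/funext => x; rewrite /Defs.coord insubN.
exact: measurable_cst.
Qed.

Definition restriction A B (x : Y A) : Y B := fun j => Defs.coord (val j) x.
Arguments restriction {A} B x.

Lemma measurable_restriction A B : measurable_fun [set: Y A] (restriction B : Y A -> Y B).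
Proof.
apply: (@measurability _ _ (Y A) (Y B) setT (restriction B) (@cylinders R p K B)) => //.
move=> _ [_ [j [U [mU ->]]] <-].
exact: (@measurable_coord A (val j) measurableT U mU).
Qed.

Lemma coord_restriction A B i (x : Y A) : i \in B ->
  Defs.coord i (restriction B x) = Defs.coord i x.
Proof. by move=> iB; rewrite /Defs.coord insubT. Qed.

(** A finite set is closed in a Hausdorff space, hence Borel, and the product is a finite
    intersection of cylinders over such sets. *)
Lemma measurable_supp_prod (mu : 'I_K -> {measure set X -> \bar R}) A :
  (forall i, finite_set (msupport (mu i))) -> measurable (supp_prod mu A : set (Y A)).
Proof.
move=> fin.
have -> : supp_prod mu A = \bigcap_(j in [set: {i | i \in A}])
    ((fun x : Y A => x j) @^-1` msupport (mu (val j))).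
  by apply/seteqP; split=> [x sx j _|x sx j]; [exact: sx|exact: (sx j I)].
apply: fin_bigcap_measurable => [|j _]; first exact: finite_finset.
apply: sub_sigma_algebra; exists j, (msupport (mu (val j))); split=> //.
rewrite -[X in measurable X]setCK; apply: measurableC; apply: sub_sigma_algebra.
apply: closed_openC; have [+ _] := @accessible_finite_set_closed 'rV[R]_p.
by apply; [exact/hausdorff_accessible/norm_hausdorff|exact: fin].
Qed.

Lemma cepsA_two_valued A (x : Y A) : cepsA N eps x = 0 \/ cepsA N eps x = +oo.
Proof.
have sum2 x' : \sum_(j : {i | i \in A}) ceps N eps x' (x j) = 0 \/
               \sum_(j : {i | i \in A}) ceps N eps x' (x j) = +oo.
  have [H|] := pselect (forall j, ceps N eps x' (x j) = 0).
    by left; rewrite big1.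
  move=> /existsNP[j Hj]; right; apply/eqP; rewrite -leye_eq (bigD1 j)//=.
  have -> : ceps N eps x' (x j) = +oo by move: Hj; rewrite /ceps; case: ifP.
  by rewrite leeDl//; apply: sume_ge0 => k _; exact: ceps_ge0.
have [[x' Hx']|H] := pselect (exists x', \sum_(j : {i | i \in A}) ceps N eps x' (x j) = 0).
  left; apply/eqP; rewrite eq_le; apply/andP; split.
    by rewrite -Hx'; apply: ereal_inf_lbound; exists x'.
  apply: le_ereal_inf_tmp => _ [y _ <-]; apply: sume_ge0 => k _; exact: ceps_ge0.
right; apply: ereal_inf_eq_pinfty => _ [y _ <-].
by case: (sum2 y) => // ?; exfalso; apply: H; exists y.
Qed.

Lemma cepsA_ge0 A (x : Y A) : 0 <= cepsA N eps x.
Proof. by case: (cepsA_two_valued x) => ->. Qed.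

(** A common point [y] for the coordinates in [A] also serves those in [B], with fewer nonnegative
    terms. *)
Lemma le_cepsA_restriction A B (x : Y A) : B \subset A ->
  cepsA N eps (restriction B x) <= cepsA N eps x.
Proof.
move=> BA; apply: le_ereal_inf_tmp => _ [y _ <-].
apply: (@le_trans _ _ (\sum_(j : {i | i \in B}) ceps N eps y (Defs.coord (val j) x))).
  by apply: ereal_inf_lbound; exists y.
(* Both sums are moved from subtypes to ['I_K], where [B \subset A] compares them. *)
rewrite -(big_sub (mem B) (fun i => ceps N eps y (Defs.coord i x))).
rewrite (eq_bigr (fun j => ceps N eps y (Defs.coord (val j) x))) => [|j _]; last first.
  by rewrite coord_val.
rewrite -(big_sub (mem A) (fun i => ceps N eps y (Defs.coord i x))).
apply: lee_sum_nneg_subset => [i|i _]; last exact: ceps_ge0.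
exact: (fintype.subsetP BA).
Qed.

Variables (mu : 'I_K -> {measure set X -> \bar R}) (L : nat).
Variable pi : forall A, {measure set (Y A) -> \bar R}.
Hypothesis L0 : (0 < L)%N.
Hypothesis hsupp : forall i, finite_set (msupport (mu i)).
Hypothesis feas : feasibleM mu (SK K) pi.

Let pi' B := mixture (nng_weight L B)
  (fun A => image_measure (pi A) (@measurable_restriction A B)).

Let cost A := \int[pi A]_(x in supp_prod mu A) (1 + cepsA N eps x).

Let cost_ge0 A : 0 <= cost A.
Proof. by apply: integral_ge0 => x _; rewrite adde_ge0// cepsA_ge0. Qed.

Lemma objM_ge0 : 0 <= objM N eps mu (SK K) pi.
Proof. by apply: sume_ge0 => A _; exact: cost_ge0. Qed.

Let subset_SK A B : B \in SKL K L -> B \subset A -> A \in SK K.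
Proof.
rewrite !inE => /andP[/set0Pn[i iB] _] /fintype.subsetP/(_ _ iB) iA.
by apply/set0Pn; exists i.
Qed.

Lemma truncated_feasibleM : feasibleM mu (SKL K L) pi'.
Proof.
split=> [B BS|i U mU].
  rewrite /pi' mixtureE big1// => A _.
  have [->|/weight_neq0[BA _]] := eqVneq (nng_weight L B A : {nonneg R})%:num%R 0%R.
    by rewrite mul0e.
  rewrite [X in _ * X](_ : _ = 0) ?mule0//.
  apply/eqP; rewrite eq_le measure_ge0 andbT -(feas.1 A (subset_SK BS BA)).
  have mA := measurable_supp_prod (A := A) hsupp.
  have mB := measurable_supp_prod (A := B) hsupp.
  (* A point whose restriction leaves the product of supports over [B] already lies outside the one
     over [A], a null set. *)
  rewrite /image_measure /= /pushforward; apply: le_measure; rewrite ?inE.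
  - rewrite -[X in measurable X]setTI; apply: measurable_restriction => //.
    exact: measurableC.
  - exact: measurableC.
  move=> x /= nB sA; apply: nB => j.
  have jA := fintype.subsetP BA _ (valP j).
  have := sA (Sub (val j) jA); rewrite /restriction -coord_val SubK.
  exact.
rewrite -(feas.2 i U mU).
rewrite -(sum_weight_marginal L0
  (a := fun A => pushforward (pi A) (Defs.coord i : Y A -> X) U)).
  apply: eq_bigr => B /andP[BS iB]; rewrite /pi' /pushforward mixtureE.
  apply: eq_bigr => A _; congr (_ * _).
  rewrite /image_measure /= /pushforward; congr (pi A _); apply/seteqP.
  by split=> x /=; rewrite coord_restriction.
by move=> A; exact: (measure_ge0 (pi A)).
Qed.

(** The integrand, extended by 0, takes only the values 0, 1 and [+oo]. *)
Let cost_le_mass A : cost A < +oo -> cost A <= pi A setT.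
Proof.
rewrite /cost integral_mkcond => fin; rewrite -[leRHS]mul1e.
apply: integral_le_two_valued => // x; rewrite patchE; case: ifP => _ //.
- by rewrite adde_ge0// cepsA_ge0.
- by case: (cepsA_two_valued x) => ->; [left; rewrite adde0|right].
- by left; rewrite lee_fin.
Qed.

Let cost_truncated_le B : B \in SKL K L ->
  \int[pi' B]_(x in supp_prod mu B) (1 + cepsA N eps x) <=
  \sum_A (weight R L A B)%:E * cost A.
Proof.
move=> BS; rewrite integral_mkcond.
set f := (fun x => 1 + _) \_ _.
have g0 A (x : Y A) : 0 <= 1 + cepsA N eps x by rewrite adde_ge0// cepsA_ge0.
have f0 x : 0 <= f x by rewrite /f patchE; case: ifP.
apply: (le_trans (integral_mixture_le _ _ f0)); apply: lee_sum => A _ /=.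
have [->|/weight_neq0[BA _]] := eqVneq (weight R L A B) 0%R.
  by rewrite !mul0e.
apply: lee_wpmul2l; first by rewrite lee_fin weight_ge0.
apply: (le_trans (integral_image_measure_le _ (@measurable_restriction A B) f0)).
(* The pointwise comparison is made on the whole space; [pi A] vanishes off its product of supports,
   which brings the integral back there. *)
apply: (@le_trans _ _ (\int[pi A]_x (1 + cepsA N eps x))).
  apply: ge0_le_lower_integral => // x; rewrite /f patchE; case: ifP => // _.
  by rewrite leeD2l// le_cepsA_restriction.
apply: integral_le_of_null_setC => //; first exact: measurable_supp_prod.
exact: feas.1 (subset_SK BS BA).
Qed.

Lemma objM_truncated_le : objM N eps mu (SK K) pi < +oo ->
  objM N eps mu (SKL K L) pi' <= objM N eps mu (SK K) pi +
    \sum_(L.+1 <= k < K.+1)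
      ((k%:R / L%:R)%R%:E * \sum_(A in SK K | #|A| == k) pi A setT).
Proof.
move=> fin.
have fincost A : A \in SK K -> cost A < +oo.
  by move=> AS; apply: (lte_sum_term (P := mem (SK K)) (F := cost)).
apply: (@le_trans _ _ (\sum_(B in SKL K L) \sum_A (weight R L A B)%:E * cost A)).
  by apply: lee_sum => B BS; exact: cost_truncated_le.
rewrite (sum_weight_mass L0)//; apply: leeD => //.
rewrite big_nat [leRHS]big_nat; apply: lee_sum => k /andP[Lk _].
have kL : (0 <= k%:R / L%:R - 1 :> R)%R.
  by rewrite subr_ge0 ler_pdivlMr ?ltr0n// mul1r ler_nat ltnW.
(* The excess [k / L - 1] times the cost is weakened to [k / L] times the mass. *)
apply: lee_pmul => //; first by apply: sume_ge0 => A _; exact: cost_ge0.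
  by rewrite lee_fin gerBl.
by apply: lee_sum => A /andP[AS _]; exact/cost_le_mass/fincost.
Qed.

End truncation_M.

(** * Comparison of the optimal values *)

Theorem proposition3p1 (R : realType) (p K L : nat)
    (N : 'rV[R]_p -> R) (eps : R)
    (mu : 'I_K -> {measure set (borelRV R p) -> \bar R})
    (hN : is_norm N) (heps : (0 < eps)%R)
    (hmass : \sum_(i < K) mu i setT = 1)
    (hsupp : forall i, finite_set (msupport (mu i)))
    (hL : (1 <= L <= K)%N) :
  (forall (lambda : {set 'I_K} -> {measure set (borelRV R p) -> \bar R})
      (m : 'I_K -> {set 'I_K} -> {measure set (borelRV R p) -> \bar R}),
    optimalB N eps mu lambda m ->
    optvalBL N eps mu L - optvalB N eps mu <=
    \sum_(L.+1 <= k < K.+1)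
      ((k%:R / L%:R - 1)%R%:E *
       \sum_(A in SK K | #|A| == k) lambda A setT)) /\
  (forall pi : forall A : {set 'I_K}, {measure set (prodRV R p A) -> \bar R},
    optimalM N eps mu (SK K) pi ->
    optvalM N eps mu (SKL K L) - optvalM N eps mu (SK K) <=
    \sum_(L.+1 <= k < K.+1)
      ((k%:R / L%:R)%R%:E *
       \sum_(A in SK K | #|A| == k) pi A setT)).
Proof.
have /andP[L0 _] := hL.
split=> [lambda m [feas opt]|pi [feas opt]].
- apply: (sube_le_of_attained (objB_ge0 N eps lambda m) opt) => [fin|].
    apply: le_trans (objB_truncated_le L0 fin).
    (* The split families, fixed by the bound just applied, are the competitors in the truncated
       problem. *)
    apply: ereal_inf_lbound; do 2 eexists; split; last by [].
    exact: truncated_feasibleB.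
  (* The range of the sum gives [L < k], so [k / L - 1] is nonnegative. *)
  rewrite big_nat; apply: sume_ge0 => k /andP[Lk _]; apply: mule_ge0.
    by rewrite lee_fin subr_ge0 ler_pdivlMr ?ltr0n// mul1r ler_nat ltnW.
  by apply: sume_ge0 => A _; exact: measure_ge0.
- apply: (sube_le_of_attained (objM_ge0 N eps mu pi) opt) => [fin|].
    apply: le_trans (objM_truncated_le L0 hsupp feas fin).
    apply: ereal_inf_lbound; eexists; split; last by [].
    exact: truncated_feasibleM.
  apply: sume_ge0 => k _; apply: mule_ge0; first by rewrite lee_fin divr_ge0.
  by apply: sume_ge0 => A _; exact: measure_ge0.
Qed.
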